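(* Let $d$ be a positive integer and let $y_1,\ldots,y_n\in S^d$ be observations of a random sample from the spherical Cauchy distribution $C_d^*(\phi)$. For $n\le3$, the maximum likelihood estimator of $\phi$, $\hat\phi_{ML}$, can be expressed as follows. (i) For $n=1$, the maximum likelihood estimator of $\phi$ is $\hat\phi_{ML}=y_1$. (ii) Suppose $n=2$. If $y_1\ne\pm y_2$, the contour of maximum likelihood of $\phi$ (the set of maximizers of the likelihood) is the circle perpendicular to the unit sphere with chord $(y_1,y_2)$ in the two-dimensional plane spanned by $y_1$ and $y_2$ (that is, the circle in this plane passing through $y_1$ and $y_2$ and meeting the unit sphere orthogonally there). When $y_1=-y_2$, the contour of maximum likelihood of $\phi$ is the line connecting $y_1$ and $y_2$. If $y_1=y_2$, then $\hat\phi_{ML}=y_1$. (iii) Assume $n=3$ and $y_j\neq y_k$ $(j\ne k)$. Then the maximum likelihood estimator of $\phi$ is $\hat\phi_{ML}=\mathcal{P}^{-1}(\hat\mu+i\hat\sigma)$, where $$\hat\mu=\frac{\|\mathcal{P}(y_1)-\mathcal{P}(y_2)\|^2\mathcal{P}(y_3)+\|\mathcal{P}(y_2)-\mathcal{P}(y_3)\|^2\mathcal{P}(y_1)+\|\mathcal{P}(y_3)-\mathcal{P}(y_1)\|^2\mathcal{P}(y_2)}{\|\mathcal{P}(y_1)-\mathcal{P}(y_2)\|^2+\|\mathcal{P}(y_2)-\mathcal{P}(y_3)\|^2+\|\mathcal{P}(y_3)-\mathcal{P}(y_1)\|^2},$$ $$\hat\sigma=\sqrt3\,\frac{\|\ma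thcal{P}(y_1)-\mathcal{P}(y_2)\|\,\|\mathcal{P}(y_2)-\mathcal{P}(y_3)\|\,\|\mathcal{P}(y_3)-\mathcal{P}(y_1)\|}{\|\mathcal{P}(y_1)-\mathcal{P}(y_2)\|^2+\|\mathcal{P}(y_2)-\mathcal{P}(y_3)\|^2+\|\mathcal{P}(y_3)-\mathcal{P}(y_1)\|^2}.$$
   Context: $S^d=\{x\in\mathbb{R}^{d+1}:\|x\|=1\}$, with $\|\cdot\|$ the Euclidean norm; $e_{d+1}$ is the $(d+1)$-th standard unit vector of $\mathbb{R}^{d+1}$. For $\phi\in\mathbb{R}^{d+1}\setminus S^d$, $C_d^*(\phi)$ has density with respect to surface area on $S^d$ $$f(y;\phi)=\frac{\Gamma\{(d+1)/2\}}{2\pi^{(d+1)/2}}\left(\frac{|1-\|\phi\|^2|}{\|y-\phi\|^2}\right)^d,\quad y\in S^d,$$ and for $\phi\in S^d$ it is the point mass at $\phi$. One has $f(y;\phi)=f(y;\phi/\|\phi\|^2)$. The likelihood of $\phi$ is $\prod_{j=1}^nf(y_j;\phi)$. The sample is assumed to come from $C_d^*(\phi)$ with $\|\phi\|<1$. Conventions. In (i) and in the case $y_1=y_2$ of (ii), $\hat\phi_{ML}=y_1$ is a boundary value at which the likelihood is unbounded. In (ii) with $y_1\ne y_2$, the likelihood is regarded as a function of $\phi\in\mathbb{R}^{d+1}\setminus S^d$, so the contour is the full circle (or full line), apart from the points $y_1,y_2$ themselves. In (iii), $\hat\phi_{ML}$ is the maximizer over $\|\phi\|<1$. $\mathcal{P}$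 is the map on $\mathbb{R}^{d+1}\cup\{\infty\}$ given by $$\mathcal{P}(x)=2\frac{(x_1,\ldots,x_d)^T}{\|x-e_{d+1}\|^2}+i\,\frac{1-\|x\|^2}{\|x-e_{d+1}\|^2},\quad x\in\mathbb{R}^{d+1}\setminus\{e_{d+1}\},$$ with $\mathcal{P}(\infty)=-i$ and $\mathcal{P}(e_{d+1})=\infty$. It takes values in $(\mathbb{R}^d+i\mathbb{R})\cup\{\infty\}$, where $\mathbb{R}^d+i\mathbb{R}$ is the set of formal expressions $\mu+i\sigma$ ($\mu\in\mathbb{R}^d$, $\sigma\in\mathbb{R}$), and $\mu+i0$ is identified with $\mu$. On $S^d$ it reduces to the stereographic projection $y\mapsto(y_1,\ldots,y_d)^T/(1-y_{d+1})$, $e_{d+1}\mapsto\infty$. Its inverse is $$\mathcal{P}^{-1}(\mu+i\sigma)=\frac{2}{\|\mu\|^2+(1+\sigma)^2}\left(\mu^T,\frac{\|\mu\|^2+\sigma^2-1}{2}\right)^T,\quad \mu+i\sigma\neq-i,$$ with $\mathcal{P}^{-1}(-i)=\infty$ and $\mathcal{P}^{-1}(\infty)=e_{d+1}$. *)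

(* Defs.v *)
From HB Require Import structures.
From mathcomp Require Import all_boot all_order all_algebra.
From mathcomp Require Import all_classical all_reals all_analysis.

Set Implicit Arguments.
Unset Strict Implicit.
Unset Printing Implicit Defensive.

Import Order.TTheory GRing.Theory Num.Theory.
Import numFieldNormedType.Exports.

Local Open Scope classical_set_scope.
Local Open Scope ring_scope.

Section Euclidean.
Variables (R : realType) (m : nat).
Implicit Types u v c x : 'rV[R]_m.

Definition dot u v : R := \sum_(i < m) u 0 i * v 0 i.

(* The library norm `|u| on row vectors is the sup norm. *)
Definition enorm u : R := Num.sqrt (dot u u).

Definition usphere : set 'rV[R]_m := [set x | enorm x = 1].

Definition uball : set 'rV[R]_m := [set x | enorm x < 1].

Definition plane u v : set 'rV[R]_m := [set x | x \in <<[:: u; v]>>%VS].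

Definition line u v : set 'rV[R]_m := range (fun t : R => u + t *: (v - u)).

Definition circle (W : set 'rV[R]_m) c (r : R) : set 'rV[R]_m :=
  [set x | W x /\ enorm (x - c) = r].

(* At a point p common to the circle in W centred at c and to the unit sphere,
   the tangent line of the circle is [set v | W v /\ dot v (p - c) = 0] and the
   tangent hyperplane of the sphere is [set w | dot w p = 0]. *)
Definition perp_usphere_at (W : set 'rV[R]_m) c p : Prop :=
  forall v w, W v -> dot v (p - c) = 0 -> dot w p = 0 -> dot v w = 0.

Definition perp_circle (y1 y2 c : 'rV[R]_m) (r : R) : Prop :=
  [/\ plane y1 y2 c, 0 < r &
      forall p, p \in [:: y1; y2] ->
        circle (plane y1 y2) c r p /\ perp_usphere_at (plane y1 y2) c p].

Definition maximizers (D : set 'rV[R]_m) (L : 'rV[R]_m -> R) : set 'rV[R]_m :=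
  [set x | D x /\ forall z, D z -> L z <= L x].

(* Points every neighbourhood of which contains points of D where L is
   arbitrarily large. *)
Definition unbounded_points (D : set 'rV[R]_m) (L : 'rV[R]_m -> R) :
    set 'rV[R]_m :=
  [set x | forall M : R, closure [set z | D z /\ M < L z] x].

End Euclidean.
Arguments usphere {R m}.
Arguments uball {R m}.

Definition Gamma (R : realType) (a : R) : R :=
  \int[@lebesgue_measure R]_(t in `]0, +oo[) (t `^ (a - 1) * expR (- t)).

Section SphericalCauchy.
Variables (R : realType) (d : nat).
Implicit Types y phi x : 'rV[R]_(d + 1).

(* Density with respect to surface area on the sphere, for phi off the sphere. *)
Definition sph_cauchy y phi : R :=
  Gamma ((d + 1)%:R / 2) / (2 * pi `^ ((d + 1)%:R / 2)) *
  (`|1 - enorm phi ^+ 2| / enorm (y - phi) ^+ 2) ^+ d.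

Definition likelihood (n : nat) (y : 'I_n -> 'rV[R]_(d + 1)) phi : R :=
  \prod_(j < n) sph_cauchy (y j) phi.

Definition e_last : 'rV[R]_(d + 1) := delta_mx 0 (rshift d ord0).

(* mu + i sigma is the pair (mu, sigma); None is the point at infinity, on both
   sides. *)
Definition Pmap (q : option 'rV[R]_(d + 1)) : option ('rV[R]_d * R) :=
  match q with
  | None => Some (0, -1)
  | Some x =>
      if x == e_last then None
      else Some ((2 / enorm (x - e_last) ^+ 2) *: lsubmx x,
                 (1 - enorm x ^+ 2) / enorm (x - e_last) ^+ 2)
  end.

Definition Pinv (q : option ('rV[R]_d * R)) : option 'rV[R]_(d + 1) :=
  match q with
  | None => Some e_last
  | Some (mu, sigma) =>
      if (mu, sigma) == (0, -1) then None
      else Some ((2 / (enorm mu ^+ 2 + (1 + sigma) ^+ 2)) *: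
                 row_mx mu (((enorm mu ^+ 2 + sigma ^+ 2 - 1) / 2)%:M))
  end.

(* The point mu of R^d with P(y) = mu + i0, for y on the sphere and different
   from e_last (see Pmap_usphere). *)
Definition stereo y : 'rV[R]_d := oapp fst 0 (Pmap (Some y)).

Lemma Pmap_usphere y : usphere y -> y != e_last ->
  Pmap (Some y) = Some (stereo y, 0).
Proof.
rewrite /usphere /stereo /Pmap /= => y1 /negPf ->.
by rewrite /= y1 expr1n subrr mul0r.
Qed.

Section ThreePoints.
Variable p : 'I_3 -> 'rV[R]_d.

Let D (j k : 'I_3) : R := enorm (p j - p k).

Definition mu_hat : 'rV[R]_d :=
  (D 0 1 ^+ 2 + D 1 2 ^+ 2 + D 2 0 ^+ 2)^-1 *:
  (D 0 1 ^+ 2 *: p 2 + D 1 2 ^+ 2 *: p 0 + D 2 0 ^+ 2 *: p 1).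

Definition sigma_hat : R :=
  Num.sqrt 3 * (D 0 1 * D 1 2 * D 2 0 /
                (D 0 1 ^+ 2 + D 1 2 ^+ 2 + D 2 0 ^+ 2)).

End ThreePoints.

(* When y_j = e_last, P(y_j) is the point at infinity and the displayed formulas
   for mu_hat and sigma_hat are read as their limits as y_j is approached by
   points z of the sphere other than e_last, i.e., as P(z) goes to infinity. *)
Definition formula_limit_at (y : 'I_3 -> 'rV[R]_(d + 1)) (j : 'I_3)
    (mu : 'rV[R]_d) (sigma : R) : Prop :=
  mu_hat (stereo \o [eta y with j |-> z])
    @[z --> within (usphere `\ y j) (nbhs (y j))] --> mu /\
  sigma_hat (stereo \o [eta y with j |-> z])
    @[z --> within (usphere `\ y j) (nbhs (y j))] --> sigma.

End SphericalCauchy.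
Arguments e_last {R d}.
Arguments stereo {R d}.

(* Main.v *)
(* Up to a positive constant the likelihood is the d-th power of the product of
   the Poisson kernels |1 - |phi|^2| / |y_j - phi|^2.

   For two points with s = <y_1, y_2> and A_j = |y_j - phi|^2,
     (1 + s) (2 A_1 A_2 - (1 - |phi|^2)^2 (1 - s))
       = ((1 + s) (1 + |phi|^2) - 2 <y_1 + y_2, phi>)^2 + 4 Gram(y_1, y_2, phi);
   the Gram determinant vanishes on the plane of y_1 and y_2, and the other square
   vanishes on the sphere centred at (y_1 + y_2) / (1 + s) that is orthogonal to
   the unit sphere.

   For three points let w_j be the squared length of the side opposite to y_j,
   b_j = w_j A_j, and P = w_1 w_2 w_3. Removing from (2 phi, 1 + |phi|^2) its
   components along the lightlike vectors (y_j, 1) for the Lorentz form leaves a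
   vector that is not timelike, which gives
     4 (b_1 b_2 + b_2 b_3 + b_3 b_1) - (b_1 + b_2 + b_3)^2 >= P (1 - |phi|^2)^2,
   and Schur's inequality bounds b_1 b_2 b_3 from below in terms of the left-hand
   side. Equality forces b_1 = b_2 = b_3 and the Lorentz component to vanish, hence
   phi = (sum_j w_j y_j) / (sum_j w_j + sqrt (3 P)), and the stereographic
   projection turns this point into mu_hat + i sigma_hat. *)

Require Import Defs.
From mathcomp Require Import all_boot all_order all_algebra.
From mathcomp Require Import all_classical all_reals all_analysis.
From mathcomp Require Import measurable_realfun.
From mathcomp Require Import ring lra.
Set Implicit Arguments.
Unset Strict Implicit.
Unset Printing Implicit Defensive.
Import Order.TTheory GRing.Theory Num.Theory.
Import numFieldNormedType.Exports.
Local Open Scope classical_set_scope.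
Local Open Scope ring_scope.

(** * Positivity of the normalizing Gamma factor *)

Section GammaPositivity.
Variable R : realType.
Implicit Types a b t : R.

(** Apply [1 + x <= expR x] at [x = t / (2 * (b + 1))] and raise to the power [b]; the factor 2
    keeps the resulting exponent below [t / 2], so half of the decay of [expR (- t)] survives. *)
Lemma powR_le_expR b t : 0 <= b -> 0 < t ->
  t `^ b <= (2 * (b + 1)) `^ b * expR (2^-1 * t).
Proof.
move=> b0 t0; have b1 : 0 < 2 * (b + 1) by lra.
have tle : t <= 2 * (b + 1) * expR (t / (2 * (b + 1))).
  rewrite mulrC -ler_pdivrMr//; apply: le_trans (expR_ge1Dx _).
  by rewrite lerDr.
apply: (le_trans (ge0_ler_powR b0 _ _ tle)); rewrite ?nnegrE ?(ltW t0)//.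
  by rewrite mulr_ge0 ?expR_ge0// ltW.
rewrite powRM ?expR_ge0 ?(ltW b1)// -expRM ler_wpM2l ?powR_ge0// ler_expR.
rewrite (_ : t / _ * b = t * (b / (2 * (b + 1)))); last by rewrite mulrAC mulrA.
by rewrite mulrC ler_pM2r// ler_pdivrMr//; lra.
Qed.

(** A multiple of the exponential density of rate 1/2 dominates the integrand, and on [[1, 2]] the
    integrand is at least [expR (-2)]. *)
Lemma Gamma_gt0 a : 1 <= a -> 0 < Gamma a.
Proof.
move=> a1; pose b := a - 1.
have b0 : 0 <= b by rewrite /b; lra.
pose f t : R := t `^ b * expR (- t).
have f0 t : 0 <= f t by rewrite mulr_ge0 ?powR_ge0 ?expR_ge0.
have mf : measurable_fun setT f.
  apply: measurable_funM; first exact: measurable_powR.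
  by apply: measurableT_comp => //; exact: measurable_funN.
pose D : set R := `]0, +oo[%classic.
have mD : measurable (D : set (measurableTypeR R)) by exact: measurable_itv.
pose c := (2 * (b + 1)) `^ b.
have fin : (\int[@lebesgue_measure R]_(t in D) (f t)%:E < +oo)%E.
  pose g t : R := 2 * c * exponential_pdf 2^-1 t.
  have ig : (@lebesgue_measure R).-integrable setT (EFin \o g).
    have -> : EFin \o g =
      fun x => ((2 * c)%:E * (EFin \o exponential_pdf 2^-1) x)%E by [].
    by apply: integrableZl => //; apply: integrable_exponential_pdf; lra.
  have ig' : (@lebesgue_measure R).-integrable D (EFin \o g).
    exact: integrableS measurableT mD (@subsetT _ _) ig.
  have := integrable_lty mD ig'; apply: le_lt_trans.
  apply: ge0_le_integral => //.
  - by move=> t _; rewrite lee_fin.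
  - by apply/measurable_EFinP; exact: measurable_funTS.
  - by case/integrableP: ig'.
  - move=> t; rewrite /D /= in_itv/= andbT => t0.
    rewrite lee_fin /g exponential_pdfE ?(ltW t0)//.
    have -> : 2 * c * (2^-1 * expR (- 2^-1 * t)) = c * expR (- 2^-1 * t).
      by field.
    rewrite /f (_ : - 2^-1 * t = 2^-1 * t + - t); last by field.
    by rewrite [in leRHS]expRD mulrA ler_wpM2r ?expR_ge0// powR_le_expR.
(* The real integral is the [fine] of the extended one, and [fine] sends [+oo] to 0; hence
   finiteness had to come first. *)
rewrite /Gamma /Rintegral -/b -/D -/f; apply: fine_gt0; rewrite fin andbT.
pose I : set R := `[1, 2]%classic.
have mI : measurable (I : set (measurableTypeR R)) by exact: measurable_itv.
have sub : I `<=` D.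
  by move=> t; rewrite /I /D /= !in_itv/= andbT; lra.
suff h : (0 < \int[@lebesgue_measure R]_(t in I) (f t)%:E)%E.
  apply: (lt_le_trans h); apply: ge0_subset_integral => //.
  - by apply/measurable_EFinP; exact: measurable_funTS.
  - by move=> t _; rewrite lee_fin.
have : (\int[@lebesgue_measure R]_(t in I) (expR (-2))%:E <=
        \int[@lebesgue_measure R]_(t in I) (f t)%:E)%E.
  apply: ge0_le_integral => //.
  - by apply/measurable_EFinP; exact: measurable_funTS.
  - move=> t; rewrite /I /= in_itv/= => /andP[t1 t2]; rewrite lee_fin /f.
    rewrite -[leLHS]mul1r ler_pM ?expR_ge0//; last by rewrite ler_expR lerN2.
    by rewrite -(powRr0 t) ler_powR.
apply: lt_le_trans.
rewrite integral_cst//= lebesgue_measure_itv/= lte_fin ltr1n.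
by rewrite -EFinD -EFinM lte_fin mulr_gt0 ?expR_gt0//; lra.
Qed.

End GammaPositivity.

(** * Algebra and continuity of the inner product *)

Section DotProduct.
Variables (R : realType) (m : nat).
Implicit Types (u v x y : 'rV[R]_m) (k : R).

Lemma dotC u v : dot u v = dot v u.
Proof. by apply: eq_bigr => i _; rewrite mulrC. Qed.

Lemma dotDl u v x : dot (u + v) x = dot u x + dot v x.
Proof. by rewrite /dot -big_split; apply: eq_bigr => i _; rewrite !mxE mulrDl. Qed.

Lemma dotZl k u x : dot (k *: u) x = k * dot u x.
Proof. by rewrite /dot mulr_sumr; apply: eq_bigr => i _; rewrite !mxE mulrA. Qed.

Lemma dotNl u x : dot (- u) x = - dot u x.
Proof. by rewrite -scaleN1r dotZl mulN1r. Qed.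

Lemma dotDr u v x : dot x (u + v) = dot x u + dot x v.
Proof. by rewrite dotC dotDl !(dotC x). Qed.

Lemma dotZr k u x : dot x (k *: u) = k * dot x u.
Proof. by rewrite dotC dotZl dotC. Qed.

Lemma dotNr u x : dot x (- u) = - dot x u.
Proof. by rewrite dotC dotNl dotC. Qed.

Definition dotE := (dotDl, dotDr, dotZl, dotZr, dotNl, dotNr).

Lemma dot0l x : dot 0 x = 0.
Proof. by rewrite -(scale0r x) dotZl mul0r. Qed.

Lemma dot_ge0 u : 0 <= dot u u.
Proof. by apply: sumr_ge0 => i _; rewrite -expr2 sqr_ge0. Qed.

Lemma dot_eq0 u : (dot u u == 0) = (u == 0).
Proof.
apply/eqP/eqP => [/eqP|->]; last exact: dot0l.
rewrite psumr_eq0 => [/allP h|i _]; last by rewrite -expr2 sqr_ge0.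
apply/rowP => i; rewrite mxE; have := h i (mem_index_enum i).
by rewrite -expr2 sqrf_eq0 => /eqP.
Qed.

Lemma dot_gt0 u : (0 < dot u u) = (u != 0).
Proof. by rewrite lt_def dot_ge0 dot_eq0 andbT. Qed.

Lemma dot_inj u v : dot (u - v) (u - v) = 0 -> u = v.
Proof. by move/eqP; rewrite dot_eq0 subr_eq0 => /eqP. Qed.

Lemma enorm_sqr u : enorm u ^+ 2 = dot u u.
Proof. by rewrite sqr_sqrtr ?dot_ge0. Qed.

Lemma enorm_ge0 u : 0 <= enorm u.
Proof. exact: sqrtr_ge0. Qed.

Lemma enormP u r : 0 <= r -> enorm u = r <-> dot u u = r ^+ 2.
Proof.
move=> r0; rewrite -enorm_sqr; split => [->//|/eqP].
by rewrite eqrXn2 ?enorm_ge0// => /eqP.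
Qed.

Lemma usphereP u : usphere u <-> dot u u = 1.
Proof. by rewrite /usphere /= enormP// expr1n. Qed.

Lemma uballP u : uball u <-> dot u u < 1.
Proof. by rewrite /uball /= -enorm_sqr expr_lt1// enorm_ge0. Qed.

Lemma dot_sub_unit u v : dot v v = 1 ->
  dot (u - dot u v *: v) (u - dot u v *: v) = dot u u - dot u v ^+ 2.
Proof. by move=> v1; rewrite !dotE v1 (dotC v u); ring. Qed.

Lemma dot_sqr_le u v : dot v v = 1 -> dot u v ^+ 2 <= dot u u.
Proof. by move=> v1; rewrite -subr_ge0 -dot_sub_unit// dot_ge0. Qed.

Lemma dot_sqr_eq u v : dot v v = 1 -> dot u v ^+ 2 = dot u u -> u = dot u v *: v.
Proof. by move=> v1 uv; apply: dot_inj; rewrite dot_sub_unit// uv subrr. Qed.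

Lemma dot_sub_gt0 u v : u <> v -> 0 < dot (u - v) (u - v).
Proof. by move=> uv; rewrite dot_gt0 subr_eq0; apply/eqP. Qed.

Lemma cvg_entry (T : Type) (F : set_system T) {FF : Filter F}
    (f : T -> 'rV[R]_m) u i : f @ F --> u -> f x 0 i @[x --> F] --> u 0 i.
Proof.
exact: (@continuous_cvg _ _ _ _ FF f (fun M : 'rV[R]_m => M 0 i) u
  (@coord_continuous _ _ _ _ _ _)).
Qed.

Lemma cvg_dot (T : Type) (F : set_system T) {FF : Filter F}
    (f g : T -> 'rV[R]_m) u v :
  f @ F --> u -> g @ F --> v -> dot (f x) (g x) @[x --> F] --> dot u v.
Proof.
move=> fu gv; rewrite /dot; apply: cvg_big => [|i _]; first exact: add_continuous.
by apply: cvgM; exact: cvg_entry.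
Qed.

End DotProduct.

(** * Reduction to Poisson kernels, and unboundedness at a single repeated observation *)

Section Likelihood.
Variables (R : realType) (d : nat).
Hypothesis d_gt0 : (0 < d)%N.
Implicit Types (p x z phi : 'rV[R]_(d + 1)).

Definition poisson p phi : R :=
  `|1 - dot phi phi| / dot (p - phi) (p - phi).

Definition sph_const : R :=
  Gamma ((d + 1)%:R / 2) / (2 * pi `^ ((d + 1)%:R / 2)).

Lemma sph_const_gt0 : 0 < sph_const.
Proof.
rewrite /sph_const divr_gt0 ?Gamma_gt0//; last first.
  by rewrite mulr_gt0// powR_gt0// pi_gt0.
by rewrite ler_pdivlMr// mul1r ler_nat addn1 ltnS.
Qed.

Lemma poisson_ge0 p phi : 0 <= poisson p phi.
Proof. by rewrite divr_ge0// dot_ge0. Qed.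

Lemma likelihoodE n (y : 'I_n -> 'rV[R]_(d + 1)) phi :
  likelihood y phi = sph_const ^+ n * (\prod_(j < n) poisson (y j) phi) ^+ d.
Proof.
rewrite /likelihood /sph_cauchy big_split/= prodr_const card_ord prodrXl.
by congr (_ * _ ^+ _); apply: eq_bigr => j _; rewrite !enorm_sqr.
Qed.

(** The constant is positive and, as [d] is positive, the [d]-th power is strictly increasing on
    nonnegative reals. *)
Lemma maximizers_likelihood n (y : 'I_n -> 'rV[R]_(d + 1)) D :
  maximizers D (likelihood y) =
  maximizers D (fun phi => \prod_(j < n) poisson (y j) phi).
Proof.
have le_likelihood z x : (likelihood y z <= likelihood y x) =
    (\prod_(j < n) poisson (y j) z <= \prod_(j < n) poisson (y j) x).
  rewrite !likelihoodE ler_pM2l ?exprn_gt0 ?sph_const_gt0//.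
  by rewrite ler_pXn2r// nnegrE prodr_ge0// => j _; apply: poisson_ge0.
by apply/seteqP; split=> x /= [Dx h]; split=> // z Dz; move: (h z Dz);
  rewrite le_likelihood.
Qed.

(** Serves both a single observation and two equal ones. Near any other point the kernel is bounded,
    while along the radius [t *: p] it equals [(1 + t) / (1 - t)], which blows up as [t] tends to
    1. *)
Lemma unbounded_likelihood n (y : 'I_n -> 'rV[R]_(d + 1)) p :
  (0 < n)%N -> (forall j, y j = p) -> usphere p ->
  unbounded_points uball (likelihood y) = [set p].
Proof.
move=> n0 yp /usphereP p1.
have LE phi : likelihood y phi = sph_const ^+ n * poisson p phi ^+ (n * d).
  rewrite likelihoodE (eq_bigr (fun=> poisson p phi)) => [|j _]; last by rewrite yp.
  by rewrite prodr_const card_ord exprM.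
have K0 : 0 < sph_const ^+ n by rewrite exprn_gt0 ?sph_const_gt0.
have nd0 : (0 < n * d)%N by rewrite muln_gt0 n0.
apply/seteqP; split=> [x xunb|_ -> M B pB] /=.
- apply: contrapT => xp; have c0 := dot_sub_gt0 (nesym xp).
  set c := dot _ _ in c0.
  have cz : dot (p - z) (p - z) @[z --> x] --> c.
    have pz : (p - z) @[z --> x] --> p - x.
      pose V : normedModType R := 'rV[R]_(d + 1).
      by apply: (@cvgB R V V (nbhs x) _ (fun=> p) id p x); [exact: cvg_cst|exact: cvg_id].
    exact: (cvg_dot pz pz).
  have c2 : c / 2 < c by lra.
  (* Inside the ball the numerator of the kernel is at most 1, and near [x] its denominator exceeds
     [c / 2]; the chosen level is the resulting bound on the likelihood. *)
  have /= [z [[/uballP z1 Mz] zc]] :=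
    xunb (sph_const ^+ n * (2 / c) ^+ (n * d)) _ (cvgr_gt _ cz _ c2).
  move: Mz; apply/negP; rewrite -leNgt LE ler_pM2l// lerXn2r ?nnegrE ?poisson_ge0//.
    by rewrite divr_ge0 ?(ltW c0).
  have z0 := dot_ge0 z.
  rewrite /poisson ger0_norm; last by lra.
  rewrite ler_pdivrMr; last by apply: lt_trans zc; lra.
  rewrite mulrAC ler_pdivlMr//; nra.
- have tp : t *: p @[t --> 1^'-] --> p.
    rewrite -[X in _ --> X]scale1r; 
    pose V : normedModType R := 'rV[R]_(d + 1).
    apply: (@cvgZr_tmp R V R (1^'-) _ id 1 p).
    by apply: cvg_at_left_filter; exact: cvg_id.
  near (1 : R)^'- => t.
  have tB : B (t *: p) by near: t; exact: tp.
  have t1 : t < 1 by near: t; exact: nbhs_left_lt.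
  have t0 : 0 < t by near: t; exact: nbhs_left_gt.
  (* This threshold makes [sph_const ^+ n / (1 - t)] exceed [M]; since the kernel is at least 1, its
     power [n * d] is no smaller than the kernel itself. *)
  have tM : 1 - sph_const ^+ n / (`|M| + 1) < t.
    by near: t; apply: nbhs_left_gt; rewrite ltrBlDr ltrDl divr_gt0// ltr_wpDl.
  have M1 : 0 < `|M| + 1 by rewrite ltr_wpDl.
  exists (t *: p); split=> //; split.
    by apply/uballP; rewrite dotZl dotZr p1; nra.
  rewrite /= LE.
  have -> : poisson p (t *: p) = (1 + t) / (1 - t).
    rewrite /poisson; have -> : p - t *: p = (1 - t) *: p by rewrite scalerBl scale1r.
    rewrite !dotE p1 !mulr1 ger0_norm; last by nra.
    by field; lra.
  have q1 : 1 <= (1 + t) / (1 - t) by rewrite ler_pdivlMr; lra.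
  apply: (@lt_le_trans _ _ (sph_const ^+ n * ((1 + t) / (1 - t)))); last first.
    by rewrite ler_pM2l// ler_eXnr.
  apply: (@lt_le_trans _ _ (sph_const ^+ n / (1 - t))); last first.
    rewrite ler_pM2l// -[leLHS]mul1r ler_pM2r ?invr_gt0; lra.
  rewrite ltr_pdivlMr; last by lra.
  have : (1 - t) * (`|M| + 1) < sph_const ^+ n.
    by rewrite -ltr_pdivlMr//; lra.
  apply: le_lt_trans; rewrite [leRHS]mulrC ler_pM2r; last by lra.
  by apply: (le_trans (ler_norm M)); lra.
Unshelve. all: by end_near.
Qed.

End Likelihood.

(** * Maximizers as level sets, and coordinates in a plane *)

Section Maximizers.
Variables (R : realType) (m : nat).
Implicit Types (D : set 'rV[R]_m) (L : 'rV[R]_m -> R).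

(** Splits each maximization below into a sharp bound, a witness and a discussion of equality. *)
Lemma maximizers_eq D L x0 M : (forall z, D z -> L z <= M) -> D x0 -> L x0 = M ->
  maximizers D L = [set x | D x /\ L x = M].
Proof.
move=> LM Dx0 Lx0; apply/seteqP; split=> x [Dx h]; split=> //.
- by apply/eqP; rewrite eq_le LM//= -Lx0 h.
- by move=> z Dz; rewrite h LM.
Qed.

Lemma planeP (u v x : 'rV[R]_m) :
  plane u v x <-> exists k l, x = k *: u + l *: v.
Proof.
rewrite /plane /= span_cons span_seq1; split.
- case/memv_addP=> _ /vlineP[k ->] [_ /vlineP[l ->] ->]; by exists k, l.
- by case=> k [l ->]; rewrite memv_add// memvZ// memv_line.
Qed.

End Maximizers.

Lemma dot_sub_unitE (R : realType) m (p phi : 'rV[R]_m) : dot p p = 1 ->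
  dot (p - phi) (p - phi) = 1 + dot phi phi - 2 * dot p phi.
Proof. by move=> p1; rewrite !dotE p1 (dotC phi p); ring. Qed.

(** * Orthogonality of a circle to the unit sphere *)

Section PerpUsphere.
Variables (R : realType) (m : nat) (W : set 'rV[R]_m) (x y c : 'rV[R]_m).
Hypotheses (x1 : dot x x = 1) (y1 : dot y y = 1) (xy : dot x y < 1).
Hypothesis WE : forall v, W v <-> exists k l, v = k *: x + l *: y.

(** Orthogonality means that the radii [x - c] and [x] are perpendicular. For the test vectors [v]
    and [w], [dot v w] is the squared length of [w], a positive multiple of [dot x (x - c) ^+ 2].
    The set [W] is abstract so that [x] and [y] can be exchanged. *)
Lemma dot_center : -1 < dot x y -> perp_usphere_at W c x -> dot x c = 1.
Proof.
move=> xyN perp; pose u := x - c.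
(* v is a tangent vector of the circle at x and w its component orthogonal
   to x. *)
pose v := dot x u *: y - dot y u *: x; pose w := v - dot v x *: x.
have vW : W v by apply/WE; exists (- dot y u), (dot x u); rewrite addrC scaleNr.
have vu : dot v u = 0 by rewrite !dotE; ring.
have wx : dot w x = 0 by rewrite dotDl dotNl dotZl x1 mulr1 subrr.
have /eqP := perp v w vW vu wx.
have -> : dot v w = dot x u ^+ 2 * ((1 - dot x y) * (1 + dot x y)).
  by rewrite !dotE x1 y1 (dotC y x); ring.
have xyB : 0 < 1 - dot x y by rewrite subr_gt0.
have xyD : 0 < 1 + dot x y by rewrite -ltrBlDl add0r.
have xy0 : (1 - dot x y) * (1 + dot x y) != 0 by rewrite gt_eqF// mulr_gt0.
rewrite mulf_eq0 (negPf xy0) orbF.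
by rewrite sqrf_eq0 !dotE x1 subr_eq0 => /eqP.
Qed.

(** The two equations make the tangent of the circle at [x] the line spanned by [x], which is normal
    to the sphere. *)
Lemma perp_usphere_center : dot x c = 1 -> dot y c = 1 -> perp_usphere_at W c x.
Proof.
move=> xc yc v w /WE[k [l ->]]; rewrite !dotE x1 xc yc (dotC y x) => h wx.
have /eqP : l * (1 - dot x y) = 0 by lra.
rewrite mulf_eq0 [_ - _ == 0]gt_eqF ?orbF ?subr_gt0//.
by move/eqP=> ->; rewrite mul0r addr0 dotC wx mulr0.
Qed.

End PerpUsphere.

(** * Maximizers for two distinct observations *)

Section TwoPoints.
Variables (R : realType) (d : nat) (p q : 'rV[R]_(d + 1)).
Hypotheses (p1 : dot p p = 1) (q1 : dot q q = 1) (pq : p <> q).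
Implicit Types phi : 'rV[R]_(d + 1).

Let s := dot p q.

Let s_lt1 : s < 1.
Proof. by have := dot_sub_gt0 pq; rewrite !dotE p1 q1 (dotC q p) -/s; lra. Qed.

Lemma dot_gtN1 : p <> - q -> -1 < s.
Proof.
move=> pNq; have := dot_sub_gt0 pNq.
by rewrite !dotE p1 q1 (dotC q p) -/s; lra.
Qed.

Let A phi := 1 + dot phi phi - 2 * dot p phi.
Let B phi := 1 + dot phi phi - 2 * dot q phi.

Let A_gt0 phi : ~ usphere phi -> 0 < A phi.
Proof.
move=> phi1; rewrite /A -dot_sub_unitE//; apply: dot_sub_gt0 => pphi.
by apply: phi1; rewrite -pphi; apply/usphereP.
Qed.

Let B_gt0 phi : ~ usphere phi -> 0 < B phi.
Proof.
move=> phi1; rewrite /B -dot_sub_unitE//; apply: dot_sub_gt0 => qphi.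
by apply: phi1; rewrite -qphi; apply/usphereP.
Qed.

Let poisson2E phi :
  poisson p phi * poisson q phi = (1 - dot phi phi) ^+ 2 / (A phi * B phi).
Proof.
rewrite /poisson !dot_sub_unitE// -/(A phi) -/(B phi) mulf_div.
by rewrite -normrM -expr2 ger0_norm ?sqr_ge0.
Qed.

Let poisson2_le phi : ~ usphere phi ->
  (1 - dot phi phi) ^+ 2 * (1 - s) <= 2 * (A phi * B phi) ->
  poisson p phi * poisson q phi <= 2 / (1 - s).
Proof.
move=> phi1 h; have s1 := s_lt1; have A0 := A_gt0 phi1; have B0 := B_gt0 phi1.
by rewrite poisson2E ler_pdivrMr ?mulr_gt0// mulrAC ler_pdivlMr//; lra.
Qed.

Let poisson2_eq phi : ~ usphere phi ->
  poisson p phi * poisson q phi = 2 / (1 - s) <->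
  (1 - dot phi phi) ^+ 2 * (1 - s) = 2 * (A phi * B phi).
Proof.
move=> phi1; have s1 := s_lt1; have A0 := A_gt0 phi1; have B0 := B_gt0 phi1.
have AB0 : A phi * B phi != 0 by rewrite gt_eqF// mulr_gt0.
have s0 : 1 - s != 0 by rewrite gt_eqF// subr_gt0.
rewrite poisson2E; split=> [/eqP|h]; first by rewrite eqr_div// => /eqP.
by apply/eqP; rewrite eqr_div//; apply/eqP.
Qed.

(** For [s = -1] the factor [1 + s] of the general identity vanishes. Instead, the gap is 8 times
    the Cauchy-Schwarz defect of [phi] and [p], which is zero exactly on the line through [p] and
    the origin. *)
Lemma maximizers_antipodal : p = - q ->
  maximizers (~` usphere) (fun phi => poisson p phi * poisson q phi) =
  line p q `\` [set p; q].
Proof.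
move=> pNq; have qNp : q = - p by rewrite pNq opprK.
have sE : s = -1 by rewrite /s pNq dotNl q1.
have qE phi : dot q phi = - dot p phi by rewrite pNq dotNl opprK.
have key phi : 2 * (A phi * B phi) - (1 - dot phi phi) ^+ 2 * (1 - s) =
    8 * (dot phi phi - dot phi p ^+ 2).
  by rewrite /A /B sE qE (dotC phi p); ring.
rewrite (@maximizers_eq _ _ _ _ 0 (2 / (1 - s))).
- apply/seteqP; split=> phi /= [h1 h2].
  + move/poisson2_eq: h2 => /(_ h1) h2; split.
      have /(dot_sqr_eq p1) -> : dot phi p ^+ 2 = dot phi phi.
        by have := key phi; rewrite h2 subrr; lra.
      exists ((1 - dot phi p) / 2) => //.
      by apply/rowP => i; rewrite qNp !mxE; field.
    by case=> E; apply: h1; apply/usphereP; rewrite E.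
  + case: h1 => t _ phiE; have {}phiE : phi = (1 - 2 * t) *: p.
      by rewrite -phiE; apply/rowP => i; rewrite qNp !mxE; ring.
    have phi1 : ~ usphere phi.
      move/usphereP; rewrite phiE !dotE p1 !mulr1 => /eqP.
      rewrite -expr2 sqrf_eq1 => /orP[] /eqP t1; apply: h2.
        by left; rewrite phiE t1 scale1r.
      by right; rewrite phiE t1 scaleN1r pNq opprK.
    split=> //; apply/poisson2_eq => //.
    by have := key phi; rewrite phiE !dotE p1; lra.
- move=> z z1; apply: poisson2_le => //; have := key z.
  have := dot_sqr_le z p1; lra.
- by move/usphereP; rewrite dot0l; lra.
- by rewrite poisson2E /A /B sE !(dotC _ 0) !dot0l; field.
Qed.

Section Circle.
Hypothesis s_gtN1 : -1 < s.

Let planeC phi : plane p q phi <-> exists k l, phi = k *: q + l *: p.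
Proof. by rewrite planeP; split=> -[k [l ->]]; exists l, k; rewrite addrC. Qed.

(** Orthogonality at both points says [dot p c = dot q c = 1], a nonsingular system for the
    coordinates of [c] in the plane; then [r ^+ 2 = dot c c - 1]. *)
Lemma perp_circleP c r : perp_circle p q c r <->
  [/\ 0 < r, c = (1 + s)^-1 *: (p + q) & r ^+ 2 = 2 / (1 + s) - 1].
Proof.
have s1 := s_lt1; have sN1 := s_gtN1; have s0 : 1 + s != 0 by rewrite gt_eqF//; lra.
have qp : dot q p = s by rewrite dotC.
split=> [[/planeP[k [l cE]] r0 h]|[r0 cE rE]].
- have [[_ pc] /(dot_center p1 q1 s1 (@planeP _ _ p q) s_gtN1) pc1] := h p (mem_head _ _).
  have qs1 : dot q p < 1 by rewrite qp.
  have qsN1 : -1 < dot q p by rewrite qp.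
  have [|_ /(dot_center q1 p1 qs1 planeC qsN1) qc1] := h q.
    by rewrite !inE eqxx orbT.
  move/(enormP _ (ltW r0)): pc.
  rewrite cE !dotE p1 q1 qp -/s !mulr1 in pc1 qc1 *.
  have kE : k = (1 + s)^-1.
    have /eqP : (1 - s) * (k * (1 + s) - 1) = 0 by nra.
    rewrite mulf_eq0 [_ - s == 0]gt_eqF ?subr_gt0//= subr_eq0 => /eqP h1.
    by rewrite -[LHS](mulfK s0) h1 mul1r.
  have lE : l = (1 + s)^-1.
    have /eqP : (1 - s) * (l * (1 + s) - 1) = 0 by nra.
    rewrite mulf_eq0 [_ - s == 0]gt_eqF ?subr_gt0//= subr_eq0 => /eqP h1.
    by rewrite -[LHS](mulfK s0) h1 mul1r.
  move=> <-; split=> //; first by rewrite kE lE scalerDr.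
  by rewrite kE lE; field.
- have pc : dot p c = 1 by rewrite cE !dotE p1 -/s; field.
  have qc : dot q c = 1 by rewrite cE !dotE q1 qp; field.
  have cc : dot c c = 2 / (1 + s) by rewrite {1}cE dotZl dotDl pc qc; field.
  have Wp : plane p q p by apply/planeP; exists 1, 0; rewrite scale1r scale0r addr0.
  have Wq : plane p q q by apply/planeP; exists 0, 1; rewrite scale1r scale0r add0r.
  split=> //.
    by apply/planeP; exists (1 + s)^-1, (1 + s)^-1; rewrite cE scalerDr.
  move=> x; rewrite !inE => /orP[] /eqP ->; (split; first split) => //.
  + by apply/(enormP _ (ltW r0)); rewrite dot_sub_unitE// cc pc rE; ring.
  + by apply: (perp_usphere_center p1 s1 (@planeP _ _ p q)).
  + by apply/(enormP _ (ltW r0)); rewrite dot_sub_unitE// cc qc rE; ring.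
  + by apply: (perp_usphere_center q1 _ planeC) => //; rewrite qp.
Qed.

Lemma perp_circle_ex : exists c r, perp_circle p q c r.
Proof.
have s1 := s_lt1; have sN1 := s_gtN1; have r0 : 0 < 2 / (1 + s) - 1.
  by rewrite subr_gt0 ltr_pdivlMr; lra.
exists ((1 + s)^-1 *: (p + q)), (Num.sqrt (2 / (1 + s) - 1)).
by apply/perp_circleP; rewrite sqrtr_gt0 sqr_sqrtr// ltW.
Qed.

(** The gap to the bound [2 / (1 - s)] is governed by a sum of two nonnegative terms, one vanishing
    on the orthogonal sphere and the other on the plane; their common zeros form the circle. *)
Lemma maximizers_circle c r : perp_circle p q c r ->
  maximizers (~` usphere) (fun phi => poisson p phi * poisson q phi) =
  circle (plane p q) c r `\` [set p; q].
Proof.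
move=> /perp_circleP[r0 cE rE].
have s1 := s_lt1; have sN1 := s_gtN1; have s0 : 1 + s != 0 by rewrite gt_eqF//; lra.
have s2 : 1 - s != 0 by rewrite gt_eqF//; lra.
have qp : dot q p = s by rewrite dotC.
pose e phi := (1 + s) * (1 + dot phi phi) - 2 * (dot p phi + dot q phi).
(* The residual of [phi] after orthogonal projection onto the plane; the coefficients come from
   inverting the Gram matrix of [p] and [q], of determinant [1 - s ^+ 2]. *)
pose f phi := phi - ((dot p phi - s * dot q phi) / (1 - s ^+ 2)) *: p
  - ((dot q phi - s * dot p phi) / (1 - s ^+ 2)) *: q.
have s3 : 1 - s ^+ 2 != 0 by rewrite (_ : 1 - _ = (1 - s) * (1 + s)) ?mulf_neq0//; ring.
have key phi : (1 + s) * (2 * (A phi * B phi) - (1 - dot phi phi) ^+ 2 * (1 - s)) =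
    e phi ^+ 2 + 4 * (1 - s ^+ 2) * dot (f phi) (f phi).
  by rewrite /A /B /e /f !dotE p1 q1 qp -/s !(dotC phi); field.
have circE phi : enorm (phi - c) = r <-> e phi = 0.
  rewrite (enormP _ (ltW r0)) rE.
  have -> : dot (phi - c) (phi - c) = e phi / (1 + s) + (2 / (1 + s) - 1).
    by rewrite cE /e !dotE p1 q1 qp -/s !(dotC phi); field.
  split=> [|->]; last by rewrite mul0r add0r.
  move=> /(canRL (addrK _)); rewrite subrr => /eqP.
  by rewrite mulf_eq0 invr_eq0 (negPf s0) orbF => /eqP.
have planeE phi : plane p q phi <-> f phi = 0.
  split=> [/planeP[k [l phiE]]|].
    by rewrite /f phiE; apply/rowP => i; rewrite !mxE !dotE p1 q1 qp -/s; field.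
  rewrite /f => /eqP; rewrite -addrA -opprD subr_eq0 => /eqP phiE.
  by apply/planeP; eexists _, _; exact: phiE.
have e_ge0 phi : 0 <= e phi ^+ 2 by exact: sqr_ge0.
have sf_ge0 phi : 0 <= 4 * (1 - s ^+ 2) * dot (f phi) (f phi).
  by rewrite mulr_ge0 ?dot_ge0//; nra.
pose t := Num.sqrt (2 * (1 - s)).
have t0 : 0 < t by rewrite sqrtr_gt0; lra.
have tE : t ^+ 2 = 2 * (1 - s) by rewrite sqr_sqrtr//; lra.
(* The point of the circle on the ray through [p + q] that is nearer to the origin: its coefficient
   is the smaller root of [2 * (1 + s) * k ^+ 2 - 4 * k + 1 = 0]. *)
pose x0 := ((2 - t) / (2 * (1 + s))) *: (p + q).
have x0E : e x0 = 0.
  have -> : e x0 = (t ^+ 2 - 2 * (1 - s)) / 2.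
    by rewrite /e /x0 !dotE p1 q1 qp -/s; field.
  by rewrite tE subrr mul0r.
have x0W : f x0 = 0 by apply/planeE/planeP; eexists _, _; exact: scalerDr.
have x01 : ~ usphere x0.
  move/usphereP => x0x0; have x0pq : dot p x0 + dot q x0 = 2 - t.
    by rewrite /x0 !dotE p1 q1 qp -/s; field.
  have := x0E; rewrite /e x0x0 x0pq; nra.
have eqE phi : ~ usphere phi ->
    poisson p phi * poisson q phi = 2 / (1 - s) <-> e phi = 0 /\ f phi = 0.
  move=> phi1; rewrite poisson2_eq//; have H := key phi.
  split=> [h|[e0 f0]]; last first.
    move/eqP: H; rewrite e0 f0 dot0l mulr0 expr0n addr0 mulf_eq0 (negPf s0) /=.
    by rewrite subr_eq0 => /eqP.
  move: H; rewrite h subrr mulr0 => /esym/eqP; rewrite paddr_eq0//.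
  rewrite sqrf_eq0 => /andP[/eqP-> /eqP h0]; split=> //; apply/eqP.
  move/eqP: h0; rewrite !mulf_eq0 (negPf s3) dot_eq0 pnatr_eq0.
  by [].
rewrite (@maximizers_eq _ _ _ _ x0 (2 / (1 - s))); last 3 first.
- move=> z z1; apply: poisson2_le => //.
  have sD : 0 < 1 + s by lra.
  rewrite -subr_ge0 -(pmulr_rge0 _ sD) key addr_ge0//.
- by [].
- by apply/eqE.
apply/seteqP; split=> phi /= [].
- move=> phi1 /eqE[//|/circE phic /planeE phiW]; split=> //.
  by case=> E; apply: phi1; apply/usphereP; rewrite E.
- move=> [phiW /circE phie] phiN.
  (* The circle meets the sphere only at [p] and [q]: on the sphere [e phi = 0] gives [k + l = 1],
     and unit length then gives [k * l = 0]. *)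
  have phi1 : ~ usphere phi.
    move/usphereP => phi1; case/planeP: (phiW) => k [l phiE].
    have dpphi : dot p phi = k + l * s by rewrite phiE !dotE p1 -/s; ring.
    have dqphi : dot q phi = k * s + l by rewrite phiE !dotE q1 qp; ring.
    have kl : k + l = 1.
      apply: (mulfI s0); move: phie; rewrite /e phi1 dpphi dqphi; nra.
    have kl0 : k * l = 0.
      apply: (mulfI s2); rewrite mulr0.
      move: phi1; rewrite {1}phiE dotDl !dotZl dpphi dqphi.
      have -> : l = 1 - k by rewrite -kl; ring.
      nra.
    apply: phiN; move/eqP: kl0; rewrite mulf_eq0 => /orP[] /eqP kl0.
      by right; rewrite phiE kl0 scale0r add0r -[l]add0r -kl0 kl scale1r.
    by left; rewrite phiE kl0 scale0r addr0 -[k]addr0 -kl0 kl scale1r.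
  by split=> //; apply/eqE => //; split=> //; apply/planeE.
Qed.

End Circle.

End TwoPoints.

(** * A sharp lower bound for a product of three positive reals *)

Section SchurBound.
Variable R : realType.
Implicit Types a b c D : R.

(** Schur's inequality of degree 3 in elementary symmetric form. For [a <= b <= c] the Schur sum is
    [a * (b - a) * (c - a) + (c - b) ^+ 2 * (c + b - a)]. *)
Lemma schur_le a b c : 0 <= a -> 0 <= b -> 0 <= c ->
  (a + b + c) * (4 * (a * b + b * c + c * a) - (a + b + c) ^+ 2) <=
  9 * (a * b * c).
Proof.
wlog ab : a b / a <= b => [H a0 b0 c0|].
  have [/H|/ltW/H] := leP a b; first exact.
  by move=> /(_ b0 a0 c0); lra.
wlog bc : a b c ab / b <= c => [H a0 b0 c0|a0 b0 c0].
  have [/(H _ _ _ ab)|/ltW cb] := leP b c; first exact.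
  have [ac|/ltW ca] := leP a c.
    by have := H _ _ _ ac cb a0 c0 b0; lra.
  by have := H _ _ _ ca ab c0 a0 b0; lra.
have h1 : 0 <= a * ((b - a) * (c - a)).
  by rewrite !mulr_ge0// subr_ge0// (le_trans ab).
have h2 : 0 <= (c - b) ^+ 2 * (c + b - a).
  by rewrite mulr_ge0 ?sqr_ge0//; lra.
lra.
Qed.

Lemma discriminant_le a b c :
  3 * (4 * (a * b + b * c + c * a) - (a + b + c) ^+ 2) <= (a + b + c) ^+ 2.
Proof.
have := sqr_ge0 (a - b); have := sqr_ge0 (b - c); have := sqr_ge0 (c - a); lra.
Qed.

(** With [e] the sum and [Q] the discriminant, chain [3 * D ^+ 3 <= 3 * Q ^+ 3 <= e ^+ 2 * Q ^+ 2 <=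
    81 * (a * b * c) ^+ 2]. *)
Lemma prod3_ge a b c D : 0 < a -> 0 < b -> 0 < c -> 0 < D ->
  D <= 4 * (a * b + b * c + c * a) - (a + b + c) ^+ 2 ->
  D ^+ 3 <= 27 * (a * b * c) ^+ 2.
Proof.
move=> a0 b0 c0 D0; have := schur_le (ltW a0) (ltW b0) (ltW c0).
have := discriminant_le a b c.
set Q := 4 * _ - _; set e := a + b + c => Qe eQ DQ.
have e0 : 0 < e by rewrite !addr_gt0.
have Q0 : 0 < Q by apply: lt_le_trans DQ.
have h1 : (e * Q) ^+ 2 <= (9 * (a * b * c)) ^+ 2.
  by rewrite lerXn2r// nnegrE ?mulr_ge0// ltW.
have h2 : 3 * Q * Q ^+ 2 <= e ^+ 2 * Q ^+ 2 by rewrite ler_wpM2r// sqr_ge0.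
have h3 : D ^+ 3 <= Q ^+ 3 by rewrite lerXn2r// nnegrE ltW.
rewrite exprMn in h1; lra.
Qed.

(** Equality makes every link of the previous chain tight: [e ^+ 2 = 3 * Q] annihilates the squared
    differences, and [Q = D] fixes the common value. *)
Lemma prod3_eq a b c D : 0 < a -> 0 < b -> 0 < c -> 0 < D ->
  D <= 4 * (a * b + b * c + c * a) - (a + b + c) ^+ 2 ->
  27 * (a * b * c) ^+ 2 = D ^+ 3 ->
  [/\ b = a, c = a & 3 * a ^+ 2 = D].
Proof.
move=> a0 b0 c0 D0 DQ eq; have := schur_le (ltW a0) (ltW b0) (ltW c0).
have dle := discriminant_le a b c; move: dle DQ.
set Q := 4 * _ - _; set e := a + b + c => Qe DQ eQ.
have e0 : 0 < e by rewrite !addr_gt0.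
have Q0 : 0 < Q by apply: lt_le_trans DQ.
have h1 : (e * Q) ^+ 2 <= (9 * (a * b * c)) ^+ 2.
  by rewrite lerXn2r// nnegrE ?mulr_ge0// ltW.
have h2 : 3 * Q * Q ^+ 2 <= e ^+ 2 * Q ^+ 2 by rewrite ler_wpM2r// sqr_ge0.
have h3 : D ^+ 3 <= Q ^+ 3 by rewrite lerXn2r// nnegrE ltW.
rewrite exprMn in h1.
have Q2 : Q ^+ 2 != 0 by rewrite gt_eqF// exprn_gt0.
have eE : e ^+ 2 = 3 * Q by apply: (mulIf Q2); lra.
have QD : Q = D.
  have /eqP : Q ^+ 3 = D ^+ 3 by lra.
  by rewrite eqrXn2 ?(ltW Q0) ?(ltW D0)// => /eqP.
have s0 : (a - b) ^+ 2 + (a - c) ^+ 2 = 0.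
  have := sqr_ge0 (b - c); have := sqr_ge0 (a - b); have := sqr_ge0 (a - c).
  move: eE; rewrite /Q /e; lra.
have /andP[/eqP ab /eqP ac] : ((a - b) ^+ 2 == 0) && ((a - c) ^+ 2 == 0).
  by rewrite -paddr_eq0 ?sqr_ge0// s0.
have bE : b = a by apply/eqP; rewrite eq_sym -subr_eq0 -sqrf_eq0 ab.
have cE : c = a by apply/eqP; rewrite eq_sym -subr_eq0 -sqrf_eq0 ac.
by split=> //; rewrite -QD /Q /e bE cE; ring.
Qed.

End SchurBound.

(** * The unique maximizer for three distinct observations *)

Section ThreePointMaximizer.
Variables (R : realType) (d : nat) (p q r : 'rV[R]_(d + 1)).
Implicit Types phi : 'rV[R]_(d + 1).

Definition sqdist m (x y : 'rV[R]_m) : R := dot (x - y) (x - y).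

Definition wt_sum : R := sqdist q r + sqdist r p + sqdist p q.

Definition wt_prod : R := sqdist q r * sqdist r p * sqdist p q.

Definition wt_vec := sqdist q r *: p + sqdist r p *: q + sqdist p q *: r.

(** The vector [wt_vec] divided by [wt_sum] is the symmedian point of the triangle, so [phi_hat] is
    a rescaling of that point. The plus sign before the root selects the solution inside the
    ball. *)
Definition phi_hat := (wt_sum + Num.sqrt (3 * wt_prod))^-1 *: wt_vec.

Hypotheses (p1 : dot p p = 1) (q1 : dot q q = 1) (r1 : dot r r = 1).
Hypotheses (pq : p <> q) (qr : q <> r) (rp : r <> p).

Let u := dot q r.
Let v := dot r p.
Let w := dot p q.
Let a := 2 - 2 * u.
Let b := 2 - 2 * v.
Let c := 2 - 2 * w.
Let S := a + b + c.
Let P := a * b * c.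
Let N := Num.sqrt (3 * P).
Let V := a *: p + b *: q + c *: r.

Let qp : dot q p = w. Proof. exact: dotC. Qed.
Let rq : dot r q = u. Proof. exact: dotC. Qed.
Let pr : dot p r = v. Proof. exact: dotC. Qed.
Let dots := (p1, q1, r1, qp, rq, pr, erefl : dot q r = u, erefl : dot r p = v,
  erefl : dot p q = w).

Let aE : sqdist q r = a. Proof. by rewrite /sqdist !dotE !dots /a; ring. Qed.
Let bE : sqdist r p = b. Proof. by rewrite /sqdist !dotE !dots /b; ring. Qed.
Let cE : sqdist p q = c. Proof. by rewrite /sqdist !dotE !dots /c; ring. Qed.

Let a_gt0 : 0 < a. Proof. by rewrite -aE; exact: dot_sub_gt0. Qed.
Let b_gt0 : 0 < b. Proof. by rewrite -bE; exact: dot_sub_gt0. Qed.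
Let c_gt0 : 0 < c. Proof. by rewrite -cE; exact: dot_sub_gt0. Qed.
Let P_gt0 : 0 < P. Proof. by rewrite !mulr_gt0. Qed.
Let S_gt0 : 0 < S. Proof. exact: addr_gt0 (addr_gt0 a_gt0 b_gt0) c_gt0. Qed.
Let N_gt0 : 0 < N. Proof. by rewrite sqrtr_gt0 mulr_gt0. Qed.
Let N2 : N ^+ 2 = 3 * P. Proof. by rewrite sqr_sqrtr// mulr_ge0// ltW. Qed.

Let phi_hatE : phi_hat = (S + N)^-1 *: V.
Proof. by rewrite /phi_hat /wt_vec /wt_sum /wt_prod aE bE cE. Qed.

Lemma dot_wt_vec : dot wt_vec wt_vec = wt_sum ^+ 2 - 3 * wt_prod.
Proof.
rewrite /wt_vec /wt_sum /wt_prod aE bE cE !dotE !dots.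
by rewrite /a /b /c; ring.
Qed.

Let A x phi := 1 + dot phi phi - 2 * dot x phi.

Let A_gt0 x phi : dot x x = 1 -> uball phi -> 0 < A x phi.
Proof.
move=> x1 /uballP phi1; rewrite /A -dot_sub_unitE//; apply: dot_sub_gt0 => xphi.
by move: phi1; rewrite -xphi x1 ltxx.
Qed.

(* (z, z0) is P times the component of (2 phi, 1 + |phi|^2) that is
   Lorentz-orthogonal to the lightlike vectors (p, 1), (q, 1), (r, 1); as
   dot z p = z0, Cauchy-Schwarz shows that it is not timelike. *)
Section LorentzProjection.
Variable phi : 'rV[R]_(d + 1).
Let bp := A p phi * a.
Let bq := A q phi * b.
Let br := A r phi * c.
Let xp := bq + br - bp.
Let xq := br + bp - bq.
Let xr := bp + bq - br.
Let z0 := P * (1 + dot phi phi) - (a * xp + b * xq + c * xr).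
Let z := (2 * P) *: phi - ((a * xp) *: p + (b * xq) *: q + (c * xr) *: r).
Let Q := 4 * (bp * bq + bq * br + br * bp) - (bp + bq + br) ^+ 2.

Let zp : dot z p = z0.
Proof.
rewrite /z /z0 !dotE !dots (dotC phi p) /xp /xq /xr /bp /bq /br /A /P /a /b /c.
by ring.
Qed.

Let zq : dot z q = z0.
Proof.
rewrite /z /z0 !dotE !dots (dotC phi q) /xp /xq /xr /bp /bq /br /A /P /a /b /c.
by ring.
Qed.

Let zz : dot z z - z0 ^+ 2 = P * (Q - P * (1 - dot phi phi) ^+ 2).
Proof.
rewrite /z /z0 !dotE !dots !(dotC phi).
rewrite /Q /xp /xq /xr /bp /bq /br /A /P /a /b /c.
by ring.
Qed.

Lemma discriminant_ge : P * (1 - dot phi phi) ^+ 2 <= Q.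
Proof.
rewrite -subr_ge0 -(pmulr_rge0 _ P_gt0) -zz -zp subr_ge0.
exact: dot_sqr_le.
Qed.

(** Equality in Cauchy-Schwarz against both [p] and [q] gives [z = z0 *: p = z0 *: q], and [p]
    differs from [q]. *)
Lemma discriminant_eq : P * (1 - dot phi phi) ^+ 2 = Q -> z0 = 0 /\ z = 0.
Proof.
move=> eqQ; have {}eqQ : dot z z = z0 ^+ 2.
  by apply/eqP; rewrite -subr_eq0 zz eqQ subrr mulr0.
have zEp : z = z0 *: p by rewrite -zp; apply: dot_sqr_eq; rewrite // zp.
have zEq : z = z0 *: q by rewrite -zq; apply: dot_sqr_eq; rewrite // zq.
have z00 : z0 = 0.
  apply/eqP; move/eqP: (zEp); rewrite zEq eq_sym -subr_eq0 -scalerBr scaler_eq0.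
  by case/orP=> [//|]; rewrite subr_eq0 => /eqP h; case: pq.
by rewrite zEp z00 scale0r.
Qed.

(** This is [prod3_ge] with [D = P * (1 - dot phi phi) ^+ 2]; the product of [bp], [bq], [br]
    carries a factor [P], so [P ^+ 2] cancels. *)
Lemma poisson3_ge : uball phi ->
  P * (1 - dot phi phi) ^+ 6 <= 27 * (A p phi * A q phi * A r phi) ^+ 2.
Proof.
move=> phi1; have dge := discriminant_ge.
have d0 : 0 < 1 - dot phi phi by move/uballP: phi1; rewrite subr_gt0.
have := @prod3_ge _ bp bq br _ _ _ _ _ dge; rewrite !mulr_gt0 ?A_gt0 ?exprn_gt0//.
move=> /(_ isT isT isT isT) h.
rewrite -(ler_pM2l (exprn_gt0 2 P_gt0)).
by move: h; rewrite /bp /bq /br /P; lra.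
Qed.

(** With [bp = bq = br], the vanishing of [z0] and [z] reads [P * (1 + dot phi phi) = bp * S] and
    [(2 * P) *: phi = bp *: V]. Adding [bp * N = P * (1 - dot phi phi)] to the first yields
    [bp * (S + N) = 2 * P], which determines [phi]. *)
Lemma poisson3_eq : uball phi ->
  27 * (A p phi * A q phi * A r phi) ^+ 2 = P * (1 - dot phi phi) ^+ 6 ->
  phi = phi_hat.
Proof.
move=> phi1 eqA; have dge := discriminant_ge.
have d0 : 0 < 1 - dot phi phi by move/uballP: phi1; rewrite subr_gt0.
have bp0 : 0 < bp by rewrite mulr_gt0 ?A_gt0.
have [||//||bqE brE bpE] := @prod3_eq _ bp bq br _ bp0 _ _ _ dge.
- by rewrite mulr_gt0 ?A_gt0.
- by rewrite mulr_gt0 ?A_gt0.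
- by rewrite mulr_gt0 ?exprn_gt0.
- move: eqA => /(congr1 (fun x => P ^+ 2 * x)); rewrite /bp /bq /br /P.
  by move=> eqA; lra.
have [z00 zE] : z0 = 0 /\ z = 0.
  by apply: discriminant_eq; rewrite /Q bqE brE -bpE; ring.
have tS : P * (1 + dot phi phi) = bp * S.
  by move: z00; rewrite /z0 /xp /xq /xr bqE brE /S; lra.
have tV : (2 * P) *: phi = bp *: V.
  move/eqP: zE; rewrite /z subr_eq0 => /eqP ->.
  by apply/rowP => i; rewrite /xp /xq /xr bqE brE !mxE; ring.
(* Both sides are nonnegative because [phi] is in the ball, so comparing squares suffices. *)
have tN : bp * N = P * (1 - dot phi phi).
  have bpN0 : 0 <= bp * N by apply/ltW/mulr_gt0.
  have Pd0 : 0 <= P * (1 - dot phi phi) by apply/ltW/mulr_gt0.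
  apply/eqP; rewrite -(@eqrXn2 _ 2)//.
  rewrite exprMn N2 [X in _ == X]exprMn.
  rewrite (_ : bp ^+ 2 * _ = P * (3 * bp ^+ 2)); last by ring.
  by rewrite bpE mulrA expr2.
have SN0 : S + N != 0 by rewrite gt_eqF// addr_gt0.
have P0 : 2 * P != 0 by rewrite gt_eqF// mulr_gt0.
have bpSN : bp = 2 * P / (S + N).
  by apply: (mulIf SN0); rewrite mulfVK// mulrDr tN -tS; ring.
apply: (scalerI P0); rewrite tV bpSN phi_hatE scalerA //.
Qed.

End LorentzProjection.

Let SN_gt0 : 0 < S + N. Proof. exact: addr_gt0. Qed.

Let phi_hat2 : 1 - dot phi_hat phi_hat = 2 * N / (S + N).
Proof.
have SN0 : S + N != 0 by rewrite gt_eqF.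
have : dot V V = S ^+ 2 - N ^+ 2.
  by rewrite N2 /V !dotE !dots /S /P /a /b /c; ring.
rewrite phi_hatE dotZl dotZr => ->.
by rewrite subr_sqr; field.
Qed.

Lemma uball_phi_hat : uball phi_hat.
Proof. by apply/uballP; rewrite -subr_gt0 phi_hat2 !mulr_gt0// invr_gt0. Qed.

Let A_phi_hat : A p phi_hat * A q phi_hat * A r phi_hat = 8 * P ^+ 2 / (S + N) ^+ 3.
Proof.
have SN0 : S + N != 0 by rewrite gt_eqF.
have AE x : A x phi_hat = 2 * (S - dot x V) / (S + N).
  rewrite /A (_ : dot phi_hat phi_hat = 1 - 2 * N / (S + N)); last first.
    by rewrite -phi_hat2; ring.
  by rewrite phi_hatE dotZr; field.
(* Since [1 - w = c / 2] and [1 - v = b / 2], [S - dot p V = b * (1 - w) + c * (1 - v) = b * c]; the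
   other two are cyclic. *)
have -> : A p phi_hat = 2 * (b * c) / (S + N).
  by rewrite AE; congr (2 * _ / _); rewrite /V !dotE !dots /S /a /b /c; ring.
have -> : A q phi_hat = 2 * (c * a) / (S + N).
  by rewrite AE; congr (2 * _ / _); rewrite /V !dotE !dots /S /a /b /c; ring.
have -> : A r phi_hat = 2 * (a * b) / (S + N).
  by rewrite AE; congr (2 * _ / _); rewrite /V !dotE !dots /S /a /b /c; ring.
by rewrite /P; field.
Qed.

Lemma maximizers_phi_hat :
  maximizers uball (fun phi => poisson p phi * poisson q phi * poisson r phi) =
  [set phi_hat].
Proof.
pose F phi := (1 - dot phi phi) ^+ 3 / (A p phi * A q phi * A r phi).
have FE phi : uball phi -> poisson p phi * poisson q phi * poisson r phi = F phi.
  move=> /uballP phi1; rewrite /poisson !dot_sub_unitE// ger0_norm; last by lra.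
  by rewrite !mulf_div -!expr2 -exprSr.
have A3_gt0 phi : uball phi -> 0 < A p phi * A q phi * A r phi.
  by move=> phi1; rewrite !mulr_gt0 ?A_gt0.
have F_ge0 phi : uball phi -> 0 <= F phi.
  move=> phi1; rewrite divr_ge0 ?(ltW (A3_gt0 _ phi1))// exprn_ge0//.
  by move/uballP: phi1; lra.
have M0 : 0 <= N ^+ 3 / P ^+ 2 by rewrite divr_ge0// exprn_ge0// ltW.
have P0 : P != 0 by rewrite gt_eqF.
(* Squaring the candidate maximum removes the root [N], so the bound and its equality case become
   polynomial. *)
have M2 : (N ^+ 3 / P ^+ 2) ^+ 2 = 27 / P.
  by rewrite expr_div_n -exprM mulnC exprM N2; field.
have Fhat : F phi_hat = N ^+ 3 / P ^+ 2.
  have SN0 : S + N != 0 by rewrite gt_eqF.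
  by rewrite /F A_phi_hat phi_hat2; field; rewrite P0.
rewrite (@maximizers_eq _ _ _ _ phi_hat (N ^+ 3 / P ^+ 2)).
- apply/seteqP; split=> phi /=.
  + case=> phi1; rewrite FE// => Feq; apply: poisson3_eq => //.
    have A0 := A3_gt0 _ phi1.
    have A3n : A p phi * A q phi * A r phi != 0 by rewrite gt_eqF.
    have : F phi ^+ 2 == 27 / P by rewrite Feq M2.
    rewrite expr_div_n -exprM eqr_div// ?expf_neq0// => /eqP h.
    by rewrite -h mulrC.
  + by move=> ->; split; [exact: uball_phi_hat|rewrite FE// ; exact: uball_phi_hat].
- move=> z z1; rewrite FE// -(@ler_pXn2r _ 2) ?nnegrE ?F_ge0// M2.
  have A0 := A3_gt0 _ z1.
  rewrite expr_div_n -exprM ler_pdivrMr ?exprn_gt0// mulrAC ler_pdivlMr//.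
  by rewrite mulrC; exact: poisson3_ge.
- exact: uball_phi_hat.
- by rewrite FE//; exact: uball_phi_hat.
Qed.

End ThreePointMaximizer.

(** * Stereographic projection of the maximizer *)

Section Stereographic.
Variables (R : realType) (d : nat).
Implicit Types (p q r x : 'rV[R]_(d + 1)).

Definition depth x : R := 1 - dot x e_last.

Lemma dot_e_last x : dot x e_last = x 0 (rshift d ord0).
Proof.
rewrite /dot (bigD1 (rshift d ord0))//= mxE !eqxx mulr1 big1 ?addr0// => i ne.
by rewrite mxE (negPf ne) andbF mulr0.
Qed.

Lemma e_last_unit : dot (e_last : 'rV[R]_(d + 1)) e_last = 1.
Proof. by rewrite dot_e_last mxE !eqxx. Qed.

Lemma row_e_last x : x = row_mx (lsubmx x) (dot x e_last)%:M.
Proof.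
rewrite -[LHS]hsubmxK; congr row_mx; apply/rowP => i.
by rewrite ord1 dot_e_last !mxE eqxx mulr1n.
Qed.

Lemma dot_lsubmx p q :
  dot (lsubmx p) (lsubmx q) = dot p q - dot p e_last * dot q e_last.
Proof.
rewrite !dot_e_last; apply/eqP; rewrite eq_sym subr_eq; apply/eqP.
rewrite /dot big_split_ord big_ord1; congr (_ + _).
by apply: eq_bigr => i _; rewrite !mxE.
Qed.

Lemma sqdist_e_last x : dot x x = 1 -> sqdist x e_last = 2 * depth x.
Proof. by move=> x1; rewrite /sqdist dot_sub_unitE// e_last_unit /depth; ring. Qed.

Lemma depth_ge0 x : dot x x = 1 -> 0 <= depth x.
Proof.
move=> x1; have := dot_ge0 (x - e_last).
by rewrite -/(sqdist _ _) sqdist_e_last//; lra.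
Qed.

Lemma depth_gt0 x : dot x x = 1 -> x != e_last -> 0 < depth x.
Proof.
by move=> x1 /eqP/dot_sub_gt0; rewrite -/(sqdist _ _) sqdist_e_last//; lra.
Qed.

Lemma stereoE x : dot x x = 1 -> x != e_last ->
  stereo x = (depth x)^-1 *: lsubmx x.
Proof.
move=> x1 xe; have h0 := depth_gt0 x1 xe.
rewrite /stereo /Pmap (negPf xe) /= enorm_sqr -/(sqdist _ _) sqdist_e_last//.
by congr (_ *: _); field; rewrite gt_eqF.
Qed.

(** The distance law of an inversion: the projection is the restriction to the sphere of the
    inversion of radius [Num.sqrt 2] centred at the pole [e_last]. *)
Lemma sqdist_stereo p q : dot p p = 1 -> dot q q = 1 ->
  p != e_last -> q != e_last ->
  sqdist (stereo p) (stereo q) = sqdist p q / (depth p * depth q).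
Proof.
move=> p1 q1 pe qe; rewrite !stereoE// /sqdist !dotE !dot_lsubmx p1 q1.
rewrite !(dotC q p) /depth.
have := depth_gt0 p1 pe; have := depth_gt0 q1 qe; rewrite /depth => hq hp.
by field; rewrite !gt_eqF.
Qed.

(* The denominator of mu_hat and sigma_hat multiplied by the three depths: the
   formulas in terms of wt_depth also make sense when one point is e_last. *)
Definition wt_depth p q r : R :=
  sqdist q r * depth p + sqdist r p * depth q + sqdist p q * depth r.

Definition mu_proj p q r : 'rV[R]_d :=
  (wt_depth p q r)^-1 *: lsubmx (wt_vec p q r).

Definition sigma_proj p q r : R :=
  Num.sqrt (3 * wt_prod p q r) / wt_depth p q r.

(** Among distinct points at most one is the pole, so some depth is positive. *)
Lemma wt_depth_gt0 p q r : dot p p = 1 -> dot q q = 1 -> dot r r = 1 ->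
  p <> q -> q <> r -> r <> p -> 0 < wt_depth p q r.
Proof.
move=> p1 q1 r1 pq qr rp; rewrite /wt_depth.
have [/dot_sub_gt0 a0 /dot_sub_gt0 b0 /dot_sub_gt0 c0] := And3 qr rp pq.
have [hp hq hr] := And3 (depth_ge0 p1) (depth_ge0 q1) (depth_ge0 r1).
rewrite -!/(sqdist _ _) in a0 b0 c0.
have ra : 0 <= sqdist q r * depth p by rewrite mulr_ge0// ltW.
have rb : 0 <= sqdist r p * depth q by rewrite mulr_ge0// ltW.
have rc : 0 <= sqdist p q * depth r by rewrite mulr_ge0// ltW.
have [pe|/(depth_gt0 p1) hp0] := eqVneq p e_last; last first.
  by rewrite !ltr_wpDr// mulr_gt0.
have hq0 : 0 < depth q.
  by apply: depth_gt0 => //; apply/eqP => qe; apply: pq; rewrite pe qe.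
by rewrite ltr_wpDr// ltr_wpDl// mulr_gt0.
Qed.

Lemma wt_depthE p q r : wt_depth p q r = wt_sum p q r - dot (wt_vec p q r) e_last.
Proof. by rewrite /wt_depth /wt_sum /wt_vec !dotE /depth; ring. Qed.

(** The last coordinate of [V] is [S - T] and [dot V V = S ^+ 2 - N ^+ 2], so the denominator in
    [Pinv] collapses to [2 * (S + N) / T]; the factors [T] then cancel and leave [V] over
    [S + N]. *)
Lemma Pinv_proj p q r : dot p p = 1 -> dot q q = 1 -> dot r r = 1 ->
  p <> q -> q <> r -> r <> p ->
  Pinv (Some (mu_proj p q r, sigma_proj p q r)) = Some (phi_hat p q r).
Proof.
move=> p1 q1 r1 pq qr rp; have T0 := wt_depth_gt0 p1 q1 r1 pq qr rp.
have V2 := dot_wt_vec p1 q1 r1; have TE := wt_depthE p q r.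
have P0 : 0 <= 3 * wt_prod p q r by rewrite !mulr_ge0 ?dot_ge0.
have S0 : 0 < wt_sum p q r.
  by rewrite /wt_sum !addr_gt0// dot_sub_gt0.
rewrite /Pinv /mu_proj /sigma_proj /phi_hat enorm_sqr !dotE dot_lsubmx V2.
have N2 := sqr_sqrtr P0; move: (sqrtr_ge0 (3 * wt_prod p q r)) N2 => N0 N2.
set N := Num.sqrt _ in N0 N2 *; rewrite -N2; set S := wt_sum p q r in TE S0 *.
set T := wt_depth p q r in TE T0 *; set V := wt_vec p q r in TE *.
have Ve : dot V e_last = S - T by rewrite TE; ring.
rewrite Ve.
case: ifP => [/eqP[_ NT]|_].
  by exfalso; have : 0 <= N / T; [rewrite divr_ge0// ltW|rewrite NT; lra].
have T0' : T != 0 by rewrite gt_eqF.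
have SN0 : S + N != 0 by rewrite gt_eqF// ltr_pwDl.
congr Some; rewrite [V in RHS]row_e_last Ve.
have -> : T^-1 * (T^-1 * (S ^+ 2 - N ^+ 2 - (S - T) * (S - T))) =
    (2 * S * T - T ^+ 2 - N ^+ 2) / T ^+ 2 by field.
have -> : (2 * S * T - T ^+ 2 - N ^+ 2) / T ^+ 2 + (1 + N / T) ^+ 2 =
  2 * (S + N) / T by field.
have -> : ((2 * S * T - T ^+ 2 - N ^+ 2) / T ^+ 2 + (N / T) ^+ 2 - 1) / 2 =
  (S - T) / T by field.
have -> : 2 / (2 * (S + N) / T) = T / (S + N) by field; rewrite SN0.
rewrite !scale_row_mx !scalerA !scale_scalar_mx; congr row_mx.
  by congr (_ *: _); field; rewrite SN0.
by congr (_%:M); field; rewrite SN0.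
Qed.

(** By [sqdist_stereo], numerators and denominators of both formulas share the factor one over the
    product of the three depths, which cancels. *)
Lemma hat_stereoE (y : 'I_3 -> 'rV[R]_(d + 1)) :
  (forall j, dot (y j) (y j) = 1) -> (forall j, y j != e_last) ->
  mu_hat (stereo \o y) = mu_proj (y 0) (y 1) (y 2) /\
  sigma_hat (stereo \o y) = sigma_proj (y 0) (y 1) (y 2).
Proof.
move=> y1 ye; rewrite /mu_hat /sigma_hat /mu_proj /sigma_proj /comp.
rewrite !enorm_sqr -!/(sqdist _ _) !sqdist_stereo//.
have h j := depth_gt0 (y1 j) (ye j).
have hn j : depth (y j) != 0 by rewrite gt_eqF.
have -> : sqdist (y 0) (y 1) / (depth (y 0) * depth (y 1)) +
    sqdist (y 1) (y 2) / (depth (y 1) * depth (y 2)) +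
    sqdist (y 2) (y 0) / (depth (y 2) * depth (y 0)) =
    wt_depth (y 0) (y 1) (y 2) / (depth (y 0) * depth (y 1) * depth (y 2)).
  by rewrite /wt_depth; field; rewrite !hn.
rewrite invf_div; split.
  apply/rowP => i; rewrite !stereoE// /wt_vec !mxE.
  move: (wt_depth (y 0) (y 1) (y 2))^-1 => k.
  by field; rewrite !hn.
have -> : enorm (stereo (y 0) - stereo (y 1)) * enorm (stereo (y 1) - stereo (y 2)) *
    enorm (stereo (y 2) - stereo (y 0)) =
    Num.sqrt (wt_prod (y 0) (y 1) (y 2)) / (depth (y 0) * depth (y 1) * depth (y 2)).
  have H0 : 0 < depth (y 0) * depth (y 1) * depth (y 2) by rewrite !mulr_gt0.
  apply/eqP; rewrite -(@eqrXn2 _ 2) ?mulr_ge0 ?enorm_ge0 ?sqrtr_ge0 ?invr_ge0 ?(ltW H0)//.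
  rewrite expr_div_n sqr_sqrtr ?mulr_ge0 ?dot_ge0// !exprMn !enorm_sqr.
  rewrite -!/(sqdist _ _) !sqdist_stereo// /wt_prod; apply/eqP.
  by field; rewrite !hn.
rewrite [Num.sqrt (3 * _)]sqrtrM//; move: (wt_depth (y 0) (y 1) (y 2))^-1 => k.
by field; rewrite !hn.
Qed.

End Stereographic.

(** * Limits of the formulas when an observation is the pole *)

Section FormulaLimit.
Variables (R : realType) (d : nat).

Lemma cvg_row (T : Type) (F : set_system T) {FF : Filter F} m
    (f : T -> 'rV[R]_m) (u : 'rV[R]_m) :
  (forall i, f x 0 i @[x --> F] --> u 0 i) -> f @ F --> u.
Proof.
move=> fu B [P Pu PB]; apply: (@filterS _ F _ [set x | forall i, P 0 i (f x 0 i)]).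
  by move=> x Px; apply: PB => i j; rewrite ord1.
by apply: filter_forall => i; apply: fu; exact: Pu.
Qed.

Lemma cvg_sqdist (T : Type) (F : set_system T) {FF : Filter F} m
    (f g : T -> 'rV[R]_m) (u v : 'rV[R]_m) :
  f @ F --> u -> g @ F --> v -> sqdist (f x) (g x) @[x --> F] --> sqdist u v.
Proof.
move=> fu gv; pose V : normedModType R := 'rV[R]_m.
have fg : (f x - g x) @[x --> F] --> u - v by exact: (@cvgB R V T F FF f g u v).
exact: (cvg_dot fg fg).
Qed.

Lemma cvg_depth (T : Type) (F : set_system T) {FF : Filter F}
    (f : T -> 'rV[R]_(d + 1)) u :
  f @ F --> u -> depth (f x) @[x --> F] --> depth u.
Proof.
move=> fu; apply: cvgB; first exact: cvg_cst.
by apply: cvg_dot => //; exact: cvg_cst.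
Qed.

Section Proj.
Variables (T : Type) (F : set_system T) (FF : Filter F).
Variables (f g h : T -> 'rV[R]_(d + 1)) (p q r : 'rV[R]_(d + 1)).
Hypotheses (fp : f @ F --> p) (gq : g @ F --> q) (hr : h @ F --> r).
Hypothesis T0 : wt_depth p q r != 0.

Let cvg_wt_depthV :
  (wt_depth (f x) (g x) (h x))^-1 @[x --> F] --> (wt_depth p q r)^-1.
Proof.
apply: cvgV => //; apply: cvgD; first apply: cvgD.
- by apply: cvgM; [exact: cvg_sqdist|exact: cvg_depth].
- by apply: cvgM; [exact: cvg_sqdist|exact: cvg_depth].
- by apply: cvgM; [exact: cvg_sqdist|exact: cvg_depth].
Qed.

Lemma cvg_mu_proj : mu_proj (f x) (g x) (h x) @[x --> F] --> mu_proj p q r.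
Proof.
apply: cvg_row => i; rewrite /mu_proj /wt_vec !mxE.
under eq_fun do rewrite !mxE.
apply: cvgM => //; apply: cvgD; first apply: cvgD.
- by apply: cvgM; [exact: cvg_sqdist|exact: cvg_entry].
- by apply: cvgM; [exact: cvg_sqdist|exact: cvg_entry].
- by apply: cvgM; [exact: cvg_sqdist|exact: cvg_entry].
Qed.

Lemma cvg_sigma_proj :
  sigma_proj (f x) (g x) (h x) @[x --> F] --> sigma_proj p q r.
Proof.
apply: cvgM => //; apply: continuous_cvg; first exact: sqrt_continuous.
apply: cvgM; first exact: cvg_cst.
by apply: cvgM; [apply: cvgM|]; exact: cvg_sqdist.
Qed.

End Proj.

(** Once [y j] is replaced by another point of the sphere, no point is the pole and the formulas
    agree with [mu_proj] and [sigma_proj], which are continuous where [wt_depth] is nonzero. *)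
Lemma formula_limit_proj (y : 'I_3 -> 'rV[R]_(d + 1)) j :
  (forall k, dot (y k) (y k) = 1) -> injective y -> y j = e_last ->
  formula_limit_at y j (mu_proj (y 0) (y 1) (y 2)) (sigma_proj (y 0) (y 1) (y 2)).
Proof.
move=> y1 yi yj; rewrite /formula_limit_at; set F := within _ _.
have FF : Filter F by exact: within_filter.
pose Y z k := [eta y with j |-> z] k.
have Ycvg k : Y z k @[z --> F] --> y k.
  rewrite /Y /=; have [->|_] := eqVneq k j; last exact: cvg_cst.
  exact: cvg_within.
have Fhat : \forall z \near F,
    mu_hat (stereo \o Y z) = mu_proj (Y z 0) (Y z 1) (Y z 2) /\
    sigma_hat (stereo \o Y z) = sigma_proj (Y z 0) (Y z 1) (Y z 2).
  rewrite /F near_withinE; apply: nearW => z [/usphereP z1 /eqP zj].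
  apply: hat_stereoE => k; rewrite /Y /=; have [_|kj] := eqVneq k j => //.
  - by rewrite -yj.
  - by rewrite -yj (inj_eq yi).
have T0 : wt_depth (y 0) (y 1) (y 2) != 0.
  by rewrite gt_eqF// wt_depth_gt0//; move/yi.
split.
- apply: cvg_trans (cvg_mu_proj FF (Ycvg 0) (Ycvg 1) (Ycvg 2) T0).
  by apply: near_eq_cvg; apply: filterS Fhat => z [].
- apply: cvg_trans (cvg_sigma_proj FF (Ycvg 0) (Ycvg 1) (Ycvg 2) T0).
  by apply: near_eq_cvg; apply: filterS Fhat => z [].
Qed.

End FormulaLimit.

(** * Assembly of the cases of one, two and three observations *)

Theorem theorem10 (R : realType) (d : nat) (d_gt0 : (0 < d)%N) :
  (* (i) *)
  (forall y : 'I_1 -> 'rV[R]_(d + 1),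
     (forall j, usphere (y j)) ->
     unbounded_points uball (likelihood y) = [set y 0]) /\
  (* (ii) *)
  (forall y : 'I_2 -> 'rV[R]_(d + 1),
     (forall j, usphere (y j)) ->
     [/\ y 0 <> y 1 -> y 0 <> - y 1 ->
           (exists c r, perp_circle (y 0) (y 1) c r) /\
           (forall c r, perp_circle (y 0) (y 1) c r ->
              maximizers (~` usphere) (likelihood y) =
              circle (plane (y 0) (y 1)) c r `\` [set y 0; y 1]),
         y 0 = - y 1 ->
           maximizers (~` usphere) (likelihood y) =
           line (y 0) (y 1) `\` [set y 0; y 1]
       & y 0 = y 1 ->
           unbounded_points uball (likelihood y) = [set y 0]]) /\
  (* (iii) *)
  (forall y : 'I_3 -> 'rV[R]_(d + 1),
     (forall j, usphere (y j)) ->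
     injective y ->
     exists phi, [/\ maximizers uball (likelihood y) = [set phi],
       (forall j, y j != e_last) ->
         Some phi = Pinv (Some (mu_hat (stereo \o y), sigma_hat (stereo \o y)))
     & forall j, y j = e_last ->
         exists mu sigma, formula_limit_at y j mu sigma /\
                          Some phi = Pinv (Some (mu, sigma))]).
Proof.
split; [|split].
- move=> y y1; apply: unbounded_likelihood => // j.
  by rewrite (ord1 j).
- move=> y y1.
  have u j : dot (y j) (y j) = 1 by apply/usphereP.
  have max2 : maximizers (~` usphere) (likelihood y) =
      maximizers (~` usphere) (fun phi => poisson (y 0) phi * poisson (y 1) phi).
    rewrite maximizers_likelihood//; congr maximizers; apply/funext => phi.
    rewrite 2!big_ord_recl big_ord0 mulr1; congr (_ * poisson (y _) phi).
    exact: val_inj.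
  rewrite max2; split=> [y01 y0N1|y0N1|y01].
  + have sN := dot_gtN1 (u 0) (u 1) y0N1.
    split; first exact: perp_circle_ex.
    by move=> c r; exact: maximizers_circle.
  (* The points must be shown distinct: [y 0 = y 1 = - y 0] would make a unit vector zero. *)
  + apply: maximizers_antipodal => // y01; have /eqP := u 0.
    have : y 0 = 0 by move/eqP: y0N1; rewrite -y01 -addr_eq0 -mulr2n -scaler_nat
      scaler_eq0 pnatr_eq0 /= => /eqP.
    by move=> ->; rewrite dot0l eq_sym oner_eq0.
  + apply: unbounded_likelihood => // j.
    have [->//|j0] := eqVneq j 0.
    by rewrite y01; congr y; apply: val_inj; case: j j0 => [[|[]]].
- move=> y y1 yi.
  have u j : dot (y j) (y j) = 1 by apply/usphereP.
  have [y01 y12 y20] : [/\ y 0 <> y 1, y 1 <> y 2 & y 2 <> y 0].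
    by split=> /yi.
  exists (phi_hat (y 0) (y 1) (y 2)); split.
  + rewrite -maximizers_phi_hat// maximizers_likelihood//; congr maximizers.
    apply/funext => phi; rewrite 3!big_ord_recl big_ord0 mulr1 mulrA.
    by congr (_ * poisson (y _) phi * poisson (y _) phi); exact: val_inj.
  + by move=> ye; have [-> ->] := hat_stereoE u ye; rewrite Pinv_proj.
  + move=> j yj; eexists _, _; split; first exact: formula_limit_proj yj.
    by rewrite Pinv_proj.
Qed.
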